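(* Let $T,S\in\mathcal{B}_A(\mathcal{H})$. Then $$\omega_A(T+S)\le\frac12\left[\omega_A(T)+\omega_A(S)+\sqrt{\big(\omega_A(T)-\omega_A(S)\big)^2+4\sup_{\theta\in\mathbb{R}}\big\|\Re_A(e^{i\theta}T)\,\Re_A(e^{i\theta}S)\big\|_A}\right]\le\omega_A(T)+\omega_A(S).$$
   Context: $\mathcal{H}$ is a complex Hilbert space with inner product $\langle\cdot,\cdot\rangle$, and $A$ is a fixed nonzero positive bounded operator on $\mathcal{H}$. Set $\langle x,y\rangle_A=\langle Ax,y\rangle$ and $\|x\|_A=\|A^{1/2}x\|$. $\mathcal{B}_A(\mathcal{H})$ is the set of bounded operators $T$ for which there exists a bounded $S$ with $\langle Tx,y\rangle_A=\langle x,Sy\rangle_A$ for all $x,y$ (equivalently $\mathcal{R}(T^*A)\subseteq\mathcal{R}(A)$). For $T\in\mathcal{B}_A(\mathcal{H})$, $T^{\sharp_A}=A^\dagger T^*A$ ($A^\dagger$ the Moore–Penrose inverse) is the reduced solution of $AX=T^*A$, and $\Re_A(T)=\frac{T+T^{\sharp_A}}{2}$. For an operator $T$ with $\|Tx\|_A\le\lambda\|x\|_A$ for some $\lambda>0$ and all $x$, $\|T\|_A=\sup\{\|Tx\|_A: \|x\|_A=1\}$, and $\omega_A(T)=\sup\{|\langle Tx,x\rangle_A|:\|x\|_A=1\}$. *)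

(* Defs.v *)
From HB Require Import structures.
From mathcomp Require Import all_boot all_order all_algebra.
From mathcomp Require Import complex.
From mathcomp Require Import boolp classical_sets reals.
From mathcomp Require Import trigo.
From Stdlib Require Import ClassicalEpsilon.

Set Implicit Arguments.
Unset Strict Implicit.
Unset Printing Implicit Defensive.
Import Order.TTheory GRing.Theory Num.Theory.
Local Open Scope ring_scope.
Local Open Scope classical_set_scope.

Section Defs.
Variable R : realType.
Local Notation C := (R[i]).
Variable H : lmodType C.
Variable ip : H -> H -> C.

Definition hnorm (x : H) : R := Num.sqrt (complex.Re (ip x x)).

Record is_hilbert : Prop := IsHilbert {
  ip_linl : forall (a : C) (x y z : H), ip (a *: x + y) z = a * ip x z + ip y z;
  ip_conj : forall x y : H, ip y x = conjc (ip x y);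
  ip_ge0  : forall x : H, 0 <= ip x x;
  ip_def  : forall x : H, ip x x = 0 -> x = 0;
  ip_complete : forall u : nat -> H,
    (forall e : R, 0 < e -> exists N, forall m n, (N <= m)%N -> (N <= n)%N ->
        hnorm (u m - u n) < e) ->
    exists l : H, forall e : R, 0 < e -> exists N, forall n, (N <= n)%N ->
        hnorm (u n - l) < e }.

Definition bounded_op (T : H -> H) : Prop :=
  (forall (a : C) (x y : H), T (a *: x + y) = a *: T x + T y) /\
  exists M : R, forall x, hnorm (T x) <= M * hnorm x.

Definition positive_op (A : H -> H) : Prop :=
  bounded_op A /\ forall x, 0 <= ip (A x) x.

Definition adjoint (T : H -> H) : H -> H :=
  epsilon (inhabits (fun x : H => x))
    (fun X : H -> H => forall x y, ip (T x) y = ip x (X y)).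

Definition ipA (A : H -> H) (x y : H) : C := ip (A x) y.
Definition normA (A : H -> H) (x : H) : R := Num.sqrt (complex.Re (ipA A x x)).

Definition in_BA (A T : H -> H) : Prop :=
  bounded_op T /\
  exists S : H -> H, bounded_op S /\ forall x y, ipA A (T x) y = ipA A x (S y).

Definition in_closure_range (A : H -> H) (z : H) : Prop :=
  forall e : R, 0 < e -> exists w : H, hnorm (z - A w) < e.

(* T^{#_A}: the reduced solution of A X = T^* A (Douglas), i.e. the bounded
   solution X whose range lies in the closure of the range of A
   (this is A^dagger T^* A). *)
Definition sharpA (A T : H -> H) : H -> H :=
  epsilon (inhabits (fun x : H => x))
    (fun X : H -> H => bounded_op X /\
       (forall x, A (X x) = adjoint T (A x)) /\
       (forall x, in_closure_range A (X x))).

Definition ReA (A T : H -> H) : H -> H :=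
  fun x => (2 : C)^-1 *: (T x + sharpA A T x).

Definition opnormA (A T : H -> H) : R :=
  sup [set r : R | exists x : H, normA A x = 1 /\ r = normA A (T x)].

Definition omegaA (A T : H -> H) : R :=
  sup [set r : R | exists x : H, normA A x = 1 /\ r = ComplexField.Normc.normc (ipA A (T x) x)].

Definition expi (t : R) : C := (cos t +i* sin t)%C.

End Defs.

(* Main.v *)
(** Everything takes place in the real semi-inner product [Re <A x, y>].  Rotating
    by a phase, [omega_A (T + S)] is a supremum of values [<(P + Q) x, x>_A] with
    [P = Re_A (e^it T)] and [Q = Re_A (e^it S)], which are A-selfadjoint with
    A-norms at most [omega_A T] and [omega_A S].  With [M := omega_A (T + S)], a
    near-extremal unit vector [x] satisfies [(P + Q) x ~ M x] because
    [P + Q] has A-norm at most [M]; then [(M - P) (M - Q) x ~ P Q x], whence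
    [(M - omega_A T) (M - omega_A S) <= ||P Q||_A], and solving this quadratic
    inequality for [M] gives the first bound.  The second one is
    [||P Q||_A <= omega_A T * omega_A S].

    That the suprema are finite rests on two facts about operators having an
    A-adjoint: the reduced solution of [A X = T^* A] exists (project a bounded
    A-adjoint onto the closure of the range of [A]), and such operators are
    bounded for the A-seminorm. *)
Require Import Defs.
From HB Require Import structures.
From mathcomp Require Import all_boot all_order all_algebra.
From mathcomp Require Import complex.
From mathcomp Require Import boolp classical_sets reals.
From mathcomp Require Import trigo.
From mathcomp Require Import ring lra.
From Stdlib Require Import ClassicalEpsilon.
Import Order.TTheory GRing.Theory Num.Theory.
Local Open Scope ring_scope.
Local Open Scope classical_set_scope.


Set Implicit Arguments.
Unset Strict Implicit.
Unset Printing Implicit Defensive.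

Local Notation "r *r x" := ((real_complex _ r) *: x) (at level 40).

(** * Elementary inequalities over ordered fields *)

Lemma ler_addgt0 {R : realFieldType} (x y K : R) :
  (forall e, 0 < e -> x <= y + K * e) -> x <= y.
Proof.
move=> h; rewrite leNgt; apply/negP=> yx.
have K1 : 0 < `|K| + 1 by rewrite ltr_wpDl.
(* With this [e], [K * e] stays below half the gap [x - y]; the [+ 1] covers [K = 0]. *)
have e0 : 0 < (x - y) / (2 * (`|K| + 1)).
  by rewrite divr_gt0 ?subr_gt0// mulr_gt0.
have := h _ e0; rewrite leNgt => /negP; apply.
rewrite -ltrBrDl mulrA ltr_pdivrMr ?mulr_gt0//.
have : K * (x - y) <= `|K| * (x - y) by rewrite ler_wpM2r ?ler_norm// subr_ge0 ltW.
have : 0 <= `|K| * (x - y) by rewrite mulr_ge0// subr_ge0 ltW.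
move: yx; rewrite -subr_gt0; lra.
Qed.

Lemma affine_ge0_eq0 {R : realFieldType} (a c : R) :
  (forall t, 0 <= t * a + c) -> a = 0.
Proof.
move=> h; apply/eqP/negPn/negP=> a0.
(* At this [t] the affine function takes the value -1. *)
by have := h (- (c + 1) / a); rewrite divfK//; lra.
Qed.

(** First-order condition at a minimum: [2 * a] is the slope at 0. The test point uses the
    denominator [c + 1] so that [c = 0] is covered as well. *)
Lemma quadratic_ge0_eq0 {R : realFieldType} (a c : R) :
  0 <= c -> (forall t, 0 <= t * (2 * a) + t ^+ 2 * c) -> a = 0.
Proof.
move=> c0 h; have c1 : 0 < c + 1 by lra.
have := h (- a / (c + 1)).
have -> : - a / (c + 1) * (2 * a) + (- a / (c + 1)) ^+ 2 * c =
  - (a ^+ 2 * (c + 2)) / (c + 1) ^+ 2 by field; lra.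
rewrite pmulr_lge0 ?invr_gt0 ?exprn_gt0// oppr_ge0 pmulr_lle0; last lra.
by move=> a2; apply/eqP; rewrite -sqrf_eq0 eq_le a2 sqr_ge0.
Qed.

(** If [c < a], the powers of [a / c] are bounded by [K], whereas Bernoulli's inequality makes them
    grow at least linearly. *)
Lemma geometric_bound {R : archiRealFieldType} (a c K : R) :
  0 <= c -> (forall n, a ^+ n <= K * c ^+ n) -> a <= c.
Proof.
move=> c0 h; rewrite leNgt; apply/negP=> ca.
have [c00|cN0] := eqVneq c 0.
  have := h 1%N; rewrite c00 !expr1 mulr0 leNgt => /negP; apply.
  by rewrite -c00.
have {cN0}c0 : 0 < c by rewrite lt0r cN0.
pose q := a / c - 1.
have q0 : 0 < q by rewrite subr_gt0 ltr_pdivlMr // mul1r.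
have ber n : 1 + n%:R * q <= (1 + q) ^+ n.
  elim: n => [|n IH]; first by rewrite mul0r addr0 expr0.
  rewrite exprS; apply: (@le_trans _ _ ((1 + q) * (1 + n%:R * q))).
    have : 0 <= n%:R * q ^+ 2 by rewrite mulr_ge0 ?sqr_ge0.
    rewrite -natr1; nra.
  by rewrite ler_pM2l//; lra.
have hK n : (1 + q) ^+ n <= K.
  have := h n; rewrite -ler_pdivrMr ?exprn_gt0// -expr_div_n.
  by rewrite /q addrC subrK.
have := le_trans (ber (Num.truncn (K / q)).+1) (hK _).
have := truncnS_gt (K / q); rewrite ltr_pdivrMr// => h1 h2; lra.
Qed.

(** * Real-linear maps and semi-inner products on a complex module *)

Definition rlinear {R : realType} {V W : lmodType R[i]} (f : V -> W) :=
  forall r x y, f (r *r x + y) = r *r f x + f y.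

Section RLinear.
Variables (R : realType) (V W : lmodType R[i]) (f : V -> W) (hf : rlinear f).

Lemma rlinearD x y : f (x + y) = f x + f y.
Proof. by have := hf 1 x y; rewrite !scale1r. Qed.

Lemma rlinear0 : f 0 = 0.
Proof. by apply: (addrI (f 0)); rewrite -rlinearD !addr0. Qed.

Lemma rlinearN x : f (- x) = - f x.
Proof. by apply/eqP; rewrite -addr_eq0 -rlinearD addNr rlinear0. Qed.
End RLinear.

Section SemiInnerProduct.
Variables (R : realType) (V : lmodType R[i]).

(** Covers both [Re <x, y>] and the possibly degenerate [Re <A x, y>], so that Cauchy-Schwarz and
    the seminorm calculus are developed once for the two. *)
Record semi_ip (b : V -> V -> R) : Prop := SemiIp {
  sip_linl : forall r x y z, b (r *r x + y) z = r * b x z + b y z;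
  sip_sym : forall x y, b x y = b y x;
  sip_ge0 : forall x, 0 <= b x x }.

Definition seminorm (b : V -> V -> R) (x : V) : R := Num.sqrt (b x x).

Variables (b : V -> V -> R) (hb : semi_ip b).
Local Notation p := (seminorm b).

Lemma sipDl x y z : b (x + y) z = b x z + b y z.
Proof. by have := sip_linl hb 1 x y z; rewrite scale1r mul1r. Qed.

Lemma sip0l z : b 0 z = 0.
Proof. by have := sipDl 0 0 z; rewrite addr0; lra. Qed.

Lemma sipZl r x z : b (r *r x) z = r * b x z.
Proof. by have := sip_linl hb r x 0 z; rewrite addr0 sip0l addr0. Qed.

Lemma sipNl x z : b (- x) z = - b x z.
Proof. by have := sipDl x (- x) z; rewrite subrr sip0l; lra. Qed.

Lemma sipDr x y z : b z (x + y) = b z x + b z y.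
Proof. by rewrite !(sip_sym hb z) sipDl. Qed.

Lemma sipZr r x z : b z (r *r x) = r * b z x.
Proof. by rewrite !(sip_sym hb z) sipZl. Qed.

Lemma sipNr x z : b z (- x) = - b z x.
Proof. by rewrite !(sip_sym hb z) sipNl. Qed.

Definition sipE := (sipDl, sipDr, sipNl, sipNr, sipZl, sipZr).

(** The form may be degenerate: when [b x x = 0], the square of [t x + y] is affine and nonnegative
    in [t], so its slope vanishes. Otherwise expand the square of the multiple [b x x] of the
    component of [y] orthogonal to [x]. *)
Lemma sip_cauchy_schwarz_sqr x y : b x y ^+ 2 <= b x x * b y y.
Proof.
have [x0|x0] := eqVneq (b x x) 0.
  have h t : 0 <= t * (2 * b x y) + b y y.
    have := sip_ge0 hb (t *r x + y); rewrite !sipE x0 (sip_sym hb y x); lra.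
  have /eqP := affine_ge0_eq0 h; rewrite mulf_eq0 pnatr_eq0 /= => /eqP ->.
  by rewrite x0; lra.
have xp : 0 < b x x by rewrite lt0r x0 (sip_ge0 hb).
have E : b (b x x *r y - b x y *r x) (b x x *r y - b x y *r x) =
    b x x * (b x x * b y y - b x y ^+ 2).
  by rewrite !sipE (sip_sym hb y x); ring.
by have := sip_ge0 hb (b x x *r y - b x y *r x); rewrite E pmulr_rge0// subr_ge0.
Qed.

Lemma seminorm_ge0 x : 0 <= p x. Proof. exact: sqrtr_ge0. Qed.

Lemma sqr_seminorm x : p x ^+ 2 = b x x.
Proof. by rewrite sqr_sqrtr// (sip_ge0 hb). Qed.

Lemma sip_cauchy_schwarz x y : `|b x y| <= p x * p y.
Proof.
rewrite -(@ler_pXn2r _ 2)// ?nnegrE ?mulr_ge0 ?seminorm_ge0//.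
by rewrite real_normK ?num_real// exprMn !sqr_seminorm sip_cauchy_schwarz_sqr.
Qed.

Lemma sip_le_seminorm x y : b x y <= p x * p y.
Proof. exact: le_trans (ler_norm _) (sip_cauchy_schwarz _ _). Qed.

Lemma seminormD x y : p (x + y) <= p x + p y.
Proof.
rewrite -(@ler_pXn2r _ 2)// ?nnegrE ?addr_ge0 ?seminorm_ge0//.
have := sip_le_seminorm x y.
rewrite sqr_seminorm sqrrD !sqr_seminorm !sipE (sip_sym hb y x); lra.
Qed.

Lemma seminormN x : p (- x) = p x.
Proof. by rewrite /seminorm !sipE opprK. Qed.

Lemma seminormB x y : p (x - y) = p (y - x).
Proof. by rewrite -seminormN opprB. Qed.

Lemma seminormZ r x : p (r *r x) = `|r| * p x.
Proof.
by rewrite /seminorm !sipE mulrA -expr2 sqrtrM ?sqr_ge0// sqrtr_sqr.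
Qed.

Lemma seminorm_le_sqr x c : 0 <= c -> (p x <= c) = (b x x <= c ^+ 2).
Proof.
by move=> c0; rewrite -sqr_seminorm ler_pXn2r// nnegrE seminorm_ge0.
Qed.

Lemma ler_seminormB x y : p x - p y <= p (x - y).
Proof. by have := seminormD (x - y) y; rewrite subrK; lra. Qed.

(* Polarization bounds [b (P x) y] by [w (|x|^2 + |y|^2) / 2]; then take [y]
   proportional to [P x]. *)
Lemma seminorm_le_numerical_radius (P : V -> V) w :
  0 <= w -> rlinear P -> (forall x y, b (P x) y = b x (P y)) ->
  (forall x, `|b (P x) x| <= w * b x x) -> forall x, p (P x) <= w * p x.
Proof.
move=> w0 Plin Psym Pw x.
have pol u v : 2 * b (P u) v <= w * (b u u + b v v).
  have := Pw (u + v); have := Pw (u - v); rewrite !ler_norml !(rlinearD Plin) !(rlinearN Plin) !sipE.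
  move=> /andP[h1 _] /andP[_ h2].
  have E1 : b (P v) u = b (P u) v by rewrite Psym (sip_sym hb).
  have E2 := sip_sym hb u v; nra.
rewrite seminorm_le_sqr ?mulr_ge0 ?seminorm_ge0// exprMn sqr_seminorm.
(* For [w = 0], the polarized bound at [y = P x] already kills [P x]; otherwise the factor [w^-1]
   balances the two squares. *)
have [w00|wN0] := eqVneq w 0.
  have := pol x (P x); rewrite w00 expr2 !mul0r; lra.
have {wN0}w0 : 0 < w by rewrite lt0r wN0.
have := pol x (w^-1 *r P x); rewrite !sipE => h.
have h2 : w * (2 * (w^-1 * b (P x) (P x))) <= w * (w * (b x x + w^-1 * (w^-1 * b (P x) (P x)))).
  by rewrite ler_pM2l.
have e1 : w * (2 * (w^-1 * b (P x) (P x))) = 2 * b (P x) (P x) by field; lra.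
have e2 : w * (w * (b x x + w^-1 * (w^-1 * b (P x) (P x)))) = w ^+ 2 * b x x + b (P x) (P x).
  by field; lra.
by rewrite e1 e2 in h2; lra.
Qed.

(* By Cauchy-Schwarz [n |-> p (B^n x)] is log-convex, so it dominates the
   geometric sequence through its first two terms. *)
Lemma seminorm_le_growth (B : V -> V) c :
  0 <= c -> (forall x y, b (B x) y = b x (B y)) ->
  (forall x, exists K, forall n, p (iter n B x) <= K * c ^+ n) ->
  forall x, p (B x) <= c * p x.
Proof.
move=> c0 Bsym hK x; have [K hK'] := hK x.
pose a n := p (iter n B x).
have a0 n : 0 <= a n := seminorm_ge0 _.
have conv n : a n.+1 ^+ 2 <= a n * a n.+2.
  rewrite /a sqr_seminorm iterS Bsym; exact: sip_le_seminorm.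
have [x0|xN0] := eqVneq (a 0%N) 0.
  have := conv 0%N; rewrite x0 mul0r => h.
  have -> : p (B x) = 0 by apply/eqP; rewrite -sqrf_eq0 eq_le h sqr_ge0.
  by rewrite mulr_ge0 ?seminorm_ge0.
have ax : 0 < a 0%N by rewrite lt0r xN0 a0.
have [a1|a1N] := eqVneq (a 1%N) 0.
  by rewrite -[p (B x)]/(a 1%N) a1 mulr_ge0 ?seminorm_ge0.
have a1p : 0 < a 1%N by rewrite lt0r a1N a0.
(* The ratios of consecutive terms never fall below the first one; stated without division, with
   positivity carried along in the induction. *)
have step n : 0 < a n /\ a 1%N * a n <= a 0%N * a n.+1.
  elim: n => [|n [an IH]]; first by rewrite mulrC.
  have an1 : 0 < a n.+1.
    by rewrite -(pmulr_rgt0 _ ax); apply: lt_le_trans IH; rewrite mulr_gt0.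
  split=> //; rewrite -(ler_pM2l an).
  apply: (@le_trans _ _ (a 0%N * a n.+1 ^+ 2)); first by have := conv n; nra.
  by rewrite [leRHS]mulrCA ler_pM2l.
rewrite -ler_pdivrMr//; apply: (@geometric_bound _ _ _ (K / a 0%N)) => // n.
have : a 0%N * (a 1%N / a 0%N) ^+ n <= a n.
  elim: n => [|n IH]; first by rewrite mulr1.
  have [_ h] := step n.
  rewrite exprSr mulrA; apply: (@le_trans _ _ (a n * (a 1%N / a 0%N))).
    by rewrite ler_wpM2r// divr_ge0.
  by rewrite mulrA ler_pdivrMr// mulrC [leRHS]mulrC.
move=> h; have := le_trans h (hK' n).
by rewrite mulrAC ler_pdivlMr// mulrC.
Qed.

Section Sum.
Variables (P Q : V -> V) (a c : R).
Hypotheses (Plin : rlinear P) (aP : forall x, p (P x) <= a * p x)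
  (cQ : forall x, p (Q x) <= c * p x).

(* Apply the reverse triangle inequality twice to
   [(M - P)(M - Q) x = M (M x - (P + Q) x) + P Q x]. *)
Lemma seminorm_resolvent_prod M x : a <= M -> c <= M ->
  (M - a) * (M - c) * p x <= `|M| * p (M *r x - (P x + Q x)) + p (P (Q x)).
Proof.
move=> aM cM.
pose y := M *r x - Q x.
have Py : M *r y - P y = M *r (M *r x - (P x + Q x)) + P (Q x).
  rewrite /y Plin (rlinearN Plin) !scalerBr !scalerDr !opprD !addrA opprK.
  by congr (_ + _); rewrite -!addrA; congr (_ + _); rewrite addrC.
have M0x z N k : (p (N z) <= k * p z) -> (M - k) * p z <= p (M *r z - N z).
  move=> h; apply: le_trans (ler_seminormB _ _); rewrite seminormZ.
  have := ler_norm M; have := seminorm_ge0 z; nra.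
have h1 : (M - c) * p x <= p y by apply: M0x.
have h2 : (M - a) * p y <= p (M *r y - P y) by apply: M0x.
have h3 : p (M *r y - P y) <= `|M| * p (M *r x - (P x + Q x)) + p (P (Q x)).
  by rewrite Py -seminormZ seminormD.
apply: le_trans (le_trans h2 h3); rewrite -mulrA ler_wpM2l ?subr_ge0//.
Qed.
End Sum.

End SemiInnerProduct.

(** * Riesz representation on a closed real subspace *)

Section Riesz.
Variables (R : realType) (V : lmodType R[i]) (b : V -> V -> R).
Hypotheses (hb : semi_ip b)
  (complete : forall u : nat -> V,
    (forall e : R, 0 < e -> exists N, forall m n, (N <= m)%N -> (N <= n)%N ->
        seminorm b (u m - u n) < e) ->
    exists l : V, forall e : R, 0 < e -> exists N, forall n, (N <= n)%N ->
        seminorm b (u n - l) < e).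
Variables (M : V -> Prop).
Hypotheses (M0 : M 0) (Mlin : forall r x y, M x -> M y -> M (r *r x + y))
  (Mclosed : forall z, (forall e, 0 < e -> exists w, M w /\ seminorm b (z - w) < e) -> M z).
Local Notation p := (seminorm b).
Local Notation sipE := (sipE hb).

(* [y] minimizes [b y y - 2 f y] over [M]; minimizing sequences are Cauchy by
   the parallelogram identity. *)
Lemma riesz_closed_subspace (f : V -> R) (K : R) :
  (forall r x y, f (r *r x + y) = r * f x + f y) ->
  (forall x, f x <= K * p x) ->
  exists y, M y /\ forall x, M x -> f x = b y x.
Proof.
move=> flin fK.
have fD x y : f (x + y) = f x + f y by have := flin 1 x y; rewrite scale1r mul1r.
have f0 : f 0 = 0 by have := fD 0 0; rewrite addr0; lra.
have fZ r x : f (r *r x) = r * f x by have := flin r x 0; rewrite f0 !addr0.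
pose J y := b y y - 2 * f y.
(* Since [f y <= K * p y], [J y] is at least [(p y - K)^2 - K^2]. *)
have Jlb y : - K ^+ 2 <= J y.
  have := fK y; have := sqr_seminorm hb y; have := sqr_ge0 (p y - K).
  rewrite /J; nra.
pose E := [set r | exists y, M y /\ r = J y].
have infE : has_inf E.
  split; first by exists (J 0), 0.
  by exists (- K ^+ 2) => _ [y [_ ->]].
pose d := inf E.
have dJ y : M y -> d <= J y.
  by move=> My; apply: ge_inf; [case: infE|exists y].
have eps_gt0 n : 0 < (n.+1%:R : R)^-1 by rewrite invr_gt0.
have approx n : exists y, M y /\ J y < d + (n.+1%:R)^-1.
  have [_ [y [My ->]] h] := inf_adherent (eps_gt0 n) infE.
  by exists y.
have [u hu] := boolp.choice approx.
have eps_small e : 0 < e -> exists N, forall n, (N <= n)%N -> (n.+1%:R : R)^-1 < e.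
  move=> e0; exists (Num.truncn e^-1) => n Nn.
  rewrite invf_plt ?posrE//; apply: lt_le_trans (truncnS_gt _) _.
  by rewrite ler_nat ltnS.
have [l hl] : exists l : V, forall e : R, 0 < e -> exists N, forall n, (N <= n)%N ->
        p (u n - l) < e.
  apply: complete => e e0.
  (* By the parallelogram identity the squared distance is [2 J (u m) + 2 J (u n) - 4 J] at the
     midpoint, which is at most twice the sum of the two slacks; hence [e^2 / 4] for each. *)
  have [N hN] := eps_small (e ^+ 2 / 4) ltac:(by rewrite divr_gt0 ?exprn_gt0).
  exists N => m n Nm Nn.
  have [Mm Jm] := hu m; have [Mn Jn] := hu n.
  have Mmid : M (2^-1 *r (u m + u n)).
    rewrite -[_ *r _]addr0; apply: (Mlin _ _ M0).
    by have := Mlin 1 Mm Mn; rewrite scale1r.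
  rewrite -(@ltr_pXn2r _ 2)// ?nnegrE ?(ltW e0) ?seminorm_ge0// sqr_seminorm//.
  have := dJ _ Mmid; have := hN _ Nm; have := hN _ Nn.
  move: Jm Jn; rewrite /J fZ fD !sipE (sip_sym hb (u n) (u m)).
  move: (_.+1%:R^-1) (_.+1%:R^-1) (f _) (f _) (b _ _) (b _ _) (b _ _) => *; lra.
have Ml : M l.
  apply: Mclosed => e e0; have [N hN] := hl e e0.
  exists (u N); split; first by case: (hu N).
  by rewrite seminormB// hN.
exists l; split=> // x Mx; apply/eqP; rewrite eq_sym -subr_eq0; apply/eqP.
apply: (@quadratic_ge0_eq0 _ _ (b x x)) => [|t]; first exact: sip_ge0.
(* The variation is carried out at [u n] rather than at [l]: one [e] pays for the slack of [u n] as
   a near-minimizer, [2 |t| p x] times [e] for replacing [l] by [u n]. *)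
apply: (@ler_addgt0 _ _ _ (1 + 2 * `|t| * p x)) => e e0.
have [N1 hN1] := hl e e0; have [N2 hN2] := eps_small e e0.
pose n := maxn N1 N2.
have {hN1} h1 := hN1 n (leq_maxl _ _); have {hN2} h2 := hN2 n (leq_maxr _ _).
have [Mn Jn] := hu n.
have := dJ _ (Mlin t Mx Mn).
have : t * b (u n - l) x <= `|t| * (e * p x).
  apply: le_trans (ler_norm _) _; rewrite normrM ler_wpM2l//.
  apply: le_trans (sip_cauchy_schwarz hb _ _) _.
  by rewrite ler_wpM2r ?seminorm_ge0// ltW.
move: Jn; rewrite /J flin !sipE (sip_sym hb x (u n)).
  move: h2 h1; move: (n.+1%:R^-1) => s; lra.
Qed.
End Riesz.

(** * The Hilbert space, its real form and adjoints *)

Section Hilbert.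
Variables (R : realType) (H : lmodType R[i]) (ip : H -> H -> R[i]).
Hypothesis hH : is_hilbert ip.
Local Notation re := (@complex.Re R).
Local Notation im := (@complex.Im R).
Local Notation bip := (fun x y => re (ip x y)).
Local Notation J := (Complex (0 : R) 1).

Lemma Re_add (x y : R[i]) : re (x + y) = re x + re y.
Proof. by case: x; case: y. Qed.

Lemma Re_scale r (x : R[i]) : re (real_complex _ r * x) = r * re x.
Proof. by case: x => a c /=; rewrite mul0r subr0. Qed.

Lemma Re_mul (x y : R[i]) : re (x * y) = re x * re y - im x * im y.
Proof. by case: x; case: y. Qed.

Lemma Im_mul (x y : R[i]) : im (x * y) = re x * im y + im x * re y.
Proof. by case: x => a c; case: y => e f /=. Qed.

Lemma Im_add (x y : R[i]) : im (x + y) = im x + im y.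
Proof. by case: x; case: y. Qed.

Lemma eq_ReIm (x y : R[i]) : re x = re y -> im x = im y -> x = y.
Proof. by case: x => ? ?; case: y => ? ? /= -> ->. Qed.

Lemma ipDl x y z : ip (x + y) z = ip x z + ip y z.
Proof. by have := ip_linl hH 1 x y z; rewrite scale1r mul1r. Qed.

Lemma ip0l z : ip 0 z = 0.
Proof. by apply: (addrI (ip 0 z)); rewrite -ipDl !addr0. Qed.

Lemma ipZl a x z : ip (a *: x) z = a * ip x z.
Proof. by have := ip_linl hH a x 0 z; rewrite !ip0l !addr0. Qed.

Lemma ipNl x z : ip (- x) z = - ip x z.
Proof. by apply/eqP; rewrite -addr_eq0 -ipDl addNr ip0l. Qed.

Lemma Re_ipC x y : re (ip x y) = re (ip y x).
Proof. by rewrite (ip_conj hH x y); case: (ip x y). Qed.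

Lemma Im_ipC x y : im (ip x y) = - im (ip y x).
Proof. by rewrite (ip_conj hH x y); case: (ip x y) => a c /=; rewrite opprK. Qed.

Lemma ipZr a x z : ip z (a *: x) = conjc a * ip z x.
Proof.
apply: eq_ReIm; rewrite ?(Re_ipC z) ?(Im_ipC z) ipZl ?Re_mul ?Im_mul Re_ipC Im_ipC;
  by case: a => a1 a2 /=; ring.
Qed.

Lemma ipDr x y z : ip z (x + y) = ip z x + ip z y.
Proof. by rewrite !(ip_conj hH _ z) ipDl raddfD. Qed.

Lemma ip_semi_ip : semi_ip bip.
Proof.
split=> [r x y z|x y|x]; first by rewrite ip_linl// Re_add Re_scale.
  exact: Re_ipC.
by have := ip_ge0 hH x; rewrite lecE => /andP[].
Qed.

Lemma Im_ip_self x : im (ip x x) = 0.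
Proof. by apply: ger0_Im; exact: ip_ge0. Qed.

Lemma hnorm_seminorm x : hnorm ip x = seminorm bip x.
Proof. by []. Qed.

(** Shared by the homogeneity of [hnorm] and of [normA]; [z] is the value of the form at
    [(x, x)]. *)
Lemma sqrt_Re_scale a z : im z = 0 ->
  Num.sqrt (re (a * (conjc a * z))) = ComplexField.Normc.normc a * Num.sqrt (re z).
Proof.
move=> z0; case: a => a c /=; rewrite -sqrtrM ?addr_ge0 ?sqr_ge0//.
by congr Num.sqrt; rewrite !(Re_mul, Im_mul) /= z0; ring.
Qed.

Lemma hnormZ a x : hnorm ip (a *: x) = ComplexField.Normc.normc a * hnorm ip x.
Proof. by rewrite /hnorm ipZl ipZr sqrt_Re_scale// Im_ip_self. Qed.

(* [Im z = Re (- i z)], so the real part determines a complex form. *)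
Lemma ip_Re_eq (f g : H -> R[i]) :
  (forall a x, f (a *: x) = a * f x) -> (forall a x, g (a *: x) = a * g x) ->
  (forall x, re (f x) = re (g x)) -> forall x, f x = g x.
Proof.
move=> fZ gZ h x; apply: eq_ReIm => //.
by have := h (J *: x); rewrite fZ gZ !Re_mul /=; lra.
Qed.

Lemma Re_ip_inj x y : (forall z, re (ip x z) = re (ip y z)) -> x = y.
Proof.
move=> h; apply/eqP; rewrite -subr_eq0; apply/eqP/(ip_def hH).
apply: eq_ReIm; last by rewrite Im_ip_self.
by rewrite ipDl Re_add h ipNl -Re_add subrr.
Qed.

Lemma bounded_opZ T (hT : bounded_op ip T) a x : T (a *: x) = a *: T x.
Proof.
have [Tl _] := hT; have T0 : T 0 = 0.
  by apply: (addrI (T 0)); have := Tl 1 0 0; rewrite !scale1r !addr0.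
by have := Tl a x 0; rewrite T0 !addr0.
Qed.

Lemma bounded_op_rlinear T : bounded_op ip T -> rlinear T.
Proof. by move=> [Tl _] r x y; exact: Tl. Qed.

Lemma bounded_op_bound T : bounded_op ip T ->
  exists M, 0 <= M /\ forall x, hnorm ip (T x) <= M * hnorm ip x.
Proof.
move=> [_ [M hM]]; exists `|M|; split=> // x; apply: le_trans (hM x) _.
by rewrite ler_wpM2r ?ler_norm// sqrtr_ge0.
Qed.

(** [adjoint] is chosen by [epsilon], so existence must be supplied: Riesz on the whole space
    represents [Re <T x, y>], and [ip_Re_eq] lifts this to the complex form. *)
Lemma adjointP T : bounded_op ip T ->
  forall x y, ip (T x) y = ip x (adjoint ip T y).
Proof.
move=> hT; suff : exists X, forall x y, ip (T x) y = ip x (X y).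
  exact: epsilon_spec.
suff /boolp.choice[X hX] : forall y, exists z, forall x, ip (T x) y = ip x z.
  by exists X.
move=> y; have [M [M0 hM]] := bounded_op_bound hT.
have [] := @riesz_closed_subspace _ _ bip ip_semi_ip (ip_complete hH)
  (fun=> True) I (fun _ _ _ _ _ => I) (fun _ _ => I) (fun x => re (ip (T x) y))
  (M * hnorm ip y).
- by move=> r u v; rewrite (bounded_op_rlinear hT) ip_linl// Re_add Re_scale.
- move=> x; apply: le_trans (sip_le_seminorm ip_semi_ip _ _) _.
  by rewrite mulrAC ler_wpM2r// ?hM// sqrtr_ge0.
move=> z [_ hz]; exists z; apply: ip_Re_eq => [a x|a x|x].
- by rewrite (bounded_opZ hT) ipZl.
- by rewrite ipZl.
by rewrite hz// Re_ipC.
Qed.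
End Hilbert.

(** * Phases of complex numbers *)

Section Phase.
Variable R : realType.
Local Notation normc := ComplexField.Normc.normc.

Lemma normc_nneg (z : R[i]) : 0 <= normc z.
Proof. by case: z => ? ?; exact: sqrtr_ge0. Qed.

Lemma Re_le_normc (z : R[i]) : complex.Re z <= normc z.
Proof.
case: z => a c /=; apply: le_trans (ler_norm a) _.
by rewrite -sqrtr_sqr ler_sqrt ?addr_ge0 ?sqr_ge0// lerDl sqr_ge0.
Qed.

Lemma normc_expi (t : R) : normc (expi t) = 1.
Proof. by rewrite /expi /= cos2Dsin2 sqrtr1. Qed.

Lemma Re_expi_le (t : R) (z : R[i]) : `|complex.Re (expi t * z)| <= normc z.
Proof.
have <- : normc (expi t * z) = normc z.
  by rewrite ComplexField.Normc.normcM normc_expi mul1r.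
rewrite ler_norml Re_le_normc andbT lerNl -raddfN/=.
by apply: le_trans (Re_le_normc _) _; rewrite normcN.
Qed.

Lemma normc_phase (z : R[i]) : exists t, complex.Re (expi t * z) = normc z.
Proof.
case: z => a c; rewrite /expi /=; set n := Num.sqrt _.
have n2 : n ^+ 2 = a ^+ 2 + c ^+ 2 by rewrite sqr_sqrtr// addr_ge0 ?sqr_ge0.
have n_ge0 : 0 <= n by exact: sqrtr_ge0.
clearbody n.
have [n0|nN0] := eqVneq n 0.
  exists 0; rewrite cos0 sin0 n0.
  have : a ^+ 2 = 0 by have := sqr_ge0 a; have := sqr_ge0 c; rewrite n0 in n2; nra.
  by move=> /eqP; rewrite sqrf_eq0 => /eqP ->; lra.
have np : 0 < n by rewrite lt0r nN0.
have x2 : 1 - (a / n) ^+ 2 = (c / n) ^+ 2.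
  have -> : 1 - (a / n) ^+ 2 = (n ^+ 2 - a ^+ 2) / n ^+ 2 by field.
  have -> : n ^+ 2 - a ^+ 2 = c ^+ 2 by rewrite n2; ring.
  by field.
have x1 : -1 <= a / n <= 1.
  by rewrite -ler_norml -(@expr_le1 _ 2)// real_normK ?num_real// -subr_ge0 x2 sqr_ge0.
have [_ cs] := acos_def x1.
have ss := sin_acos x1; rewrite x2 sqrtr_sqr in ss.
have E : a * (a / n) + c * (c / n) = n.
  by rewrite !mulrA -!expr2 -mulrDl -n2 expr2 mulfK.
(* The angle is minus the argument of [z]; [acos] only takes values in [[0, pi]], so the sign comes
   from the imaginary part. *)
have [c0|c0] := leP 0 (c / n).
  by exists (- acos (a / n)); rewrite cosN sinN cs ss ger0_norm// -[RHS]E; ring.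
by exists (acos (a / n)); rewrite cs ss ltr0_norm// -[RHS]E; ring.
Qed.
End Phase.

(** * The A-semi-inner product and operators with an A-adjoint *)

Section SemiHilbert.
Variables (R : realType) (H : lmodType R[i]) (ip : H -> H -> R[i]).
Hypothesis hH : is_hilbert ip.
Variables (A : H -> H) (hA : positive_op ip A).
Local Notation re := (@complex.Re R).
Local Notation im := (@complex.Im R).
Local Notation normc := ComplexField.Normc.normc.
Local Notation J := (Complex (0 : R) 1).
Local Notation bip := (fun x y => re (ip x y)).
Local Notation bA := (fun x y => re (ipA ip A x y)).
Local Notation hbip := (ip_semi_ip hH).

(** Positivity makes each [<A z, z>] real. Taking [z = x + y] matches the imaginary parts, and
    replacing [x] by [i x] then matches the real parts. *)
Lemma positive_op_selfadjoint x y : ip (A x) y = ip x (A y).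
Proof.
have [hb hpos] := hA.
have im0 z : im (ip (A z) z) = 0 := ger0_Im (hpos z).
have AD u v : A (u + v) = A u + A v := rlinearD (bounded_op_rlinear hb) u v.
have imE u v : im (ip (A u) v) = im (ip u (A v)).
  have := im0 (u + v).
  rewrite AD (ipDl hH) !(ipDr hH) !Im_add (Im_ipC hH (A v) u).
  by rewrite !im0; lra.
apply: eq_ReIm => //.
have := imE (J *: x) y.
by rewrite (bounded_opZ hb) !(ipZl hH) !Im_mul /=; lra.
Qed.

Lemma ipA_semi_ip : semi_ip bA.
Proof.
have [hb hpos] := hA.
split=> [r x y z|x y|x]; rewrite /ipA.
- by rewrite (bounded_op_rlinear hb) ip_linl// Re_add Re_scale.
- by rewrite positive_op_selfadjoint Re_ipC.
- by have := hpos x; rewrite lecE => /andP[].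
Qed.

Lemma ipAZl a x y : ipA ip A (a *: x) y = a * ipA ip A x y.
Proof. by rewrite /ipA (bounded_opZ hA.1) (ipZl hH). Qed.

Lemma normAZ a x : normA ip A (a *: x) = normc a * normA ip A x.
Proof.
rewrite /normA ipAZl /ipA (ipZr hH) sqrt_Re_scale//.
exact: ger0_Im (hA.2 x).
Qed.

Lemma ipA_cauchy_schwarz x y : normc (ipA ip A x y) <= normA ip A x * normA ip A y.
Proof.
have [t <-] := normc_phase (ipA ip A x y).
rewrite -ipAZl; apply: le_trans (sip_le_seminorm ipA_semi_ip _ _) _.
by rewrite -[seminorm _ _]/(normA ip A _) normAZ normc_expi mul1r.
Qed.

Lemma in_closure_range_linear a x y : in_closure_range ip A x ->
  in_closure_range ip A y -> in_closure_range ip A (a *: x + y).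
Proof.
move=> hx hy e e0.
have k0 : 0 < normc a + 1 by rewrite ltr_wpDl// normc_nneg.
have [w hw] := hx (e / (2 * (normc a + 1))) ltac:(by rewrite divr_gt0// mulr_gt0).
have [v hv] := hy (e / 2) ltac:(by rewrite divr_gt0).
exists (a *: w + v); rewrite hA.1.1.
have -> : a *: x + y - (a *: A w + A v) = a *: (x - A w) + (y - A v).
  by rewrite scalerBr opprD addrACA.
apply: le_lt_trans (seminormD hbip _ _) _.
rewrite -!hnorm_seminorm (hnormZ hH).
have : normc a * hnorm ip (x - A w) <= (normc a + 1) * (e / (2 * (normc a + 1))).
  by rewrite ler_pM ?normc_nneg ?sqrtr_ge0// ?lerDl// ltW.
have -> : (normc a + 1) * (e / (2 * (normc a + 1))) = e / 2 by field; lra.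
lra.
Qed.

Lemma in_closure_range_closed z :
  (forall e, 0 < e -> exists w, in_closure_range ip A w /\ hnorm ip (z - w) < e) ->
  in_closure_range ip A z.
Proof.
move=> h e e0.
have e2 : 0 < e / 2 by rewrite divr_gt0.
have [w [hw zw]] := h _ e2; have [v hv] := hw _ e2; exists v.
have -> : z - A v = (z - w) + (w - A v) by rewrite addrA subrK.
apply: le_lt_trans (seminormD hbip _ _) _.
rewrite -!hnorm_seminorm; lra.
Qed.

Lemma in_closure_range_image w : in_closure_range ip A (A w).
Proof. by move=> e e0; exists w; rewrite subrr /hnorm (ip0l hH) sqrtr0. Qed.

(** The orthogonal projection onto the closure of the range of [A]. The residue [x - P x] is
    orthogonal to that range, so the selfadjoint [A] kills it. *)
Lemma closure_range_projection : exists P : H -> H, [/\ bounded_op ip P,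
  forall x, in_closure_range ip A (P x) & forall x, A (P x) = A x].
Proof.
have A0 : A 0 = 0 := rlinear0 (bounded_op_rlinear hA.1).
have M0 : in_closure_range ip A 0 by rewrite -A0; exact: in_closure_range_image.
have /boolp.choice[P hP] : forall x, exists z, in_closure_range ip A z /\
    forall y, in_closure_range ip A y -> re (ip y x) = re (ip z y).
  move=> x.
  apply: (@riesz_closed_subspace _ _ bip hbip (ip_complete hH)
    (in_closure_range ip A) M0 (fun r => in_closure_range_linear _)
    in_closure_range_closed _ (hnorm ip x)).
  - by move=> r u v; rewrite (ip_linl hH) Re_add Re_scale.
  - by move=> y; rewrite mulrC; apply: (sip_le_seminorm hbip).
have Porth x y : in_closure_range ip A y -> re (ip (P x) y) = re (ip x y).
  by move=> hy; rewrite -(hP x).2// (Re_ipC hH).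
exists P; split=> [|x|x]; first split.
(* The linearity defect [d] lies in the closure and is orthogonal to it, hence to itself. As [Porth]
   only controls real parts, the complex scalar [a] is first moved onto [d]. *)
- move=> a x y; apply/eqP; rewrite -subr_eq0; apply/eqP/(ip_def hH).
  set d := P _ - _.
  have dM : in_closure_range ip A d.
    rewrite /d addrC -scaleN1r; apply: in_closure_range_linear; last exact: (hP _).1.
    by apply: in_closure_range_linear; exact: (hP _).1.
  have daM : in_closure_range ip A (conjc a *: d).
    by rewrite -[_ *: d]addr0; apply: in_closure_range_linear.
  apply: eq_ReIm; last by rewrite (Im_ip_self hH).
  have shift u : ip (a *: u) d = ip u (conjc a *: d).
    by rewrite (ipZl hH) (ipZr hH) conjcK.
  rewrite {1}/d (ipDl hH) (ipNl hH) -mulN1r -(rmorphN1 (real_complex R)).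
  rewrite Re_add Re_scale Porth// !(ipDl hH) !shift !Re_add !Porth//=.
  by ring.
(* [|P x|^2 = Re <x, P x> <= |x| |P x|]; then cancel [|P x|]. *)
- exists 1 => x; rewrite mul1r.
  have := sip_le_seminorm hbip x (P x); rewrite -Porth; last exact: (hP _).1.
  rewrite -(sqr_seminorm hbip) expr2 -!hnorm_seminorm.
  have [->|n0] := eqVneq (hnorm ip (P x)) 0; first by rewrite sqrtr_ge0.
  by rewrite ler_pM2r// lt0r n0 sqrtr_ge0.
- exact: (hP x).1.
- apply: (Re_ip_inj hH) => z.
  rewrite !positive_op_selfadjoint Porth//; exact: in_closure_range_image.
Qed.

(** [sharpA] is chosen by [epsilon], so a reduced solution must be exhibited: if [S] is a bounded
    A-adjoint of [T], then [A S = T^* A], and projecting [S] onto the closure of the range of [A]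
    leaves [A S] unchanged. *)
Lemma sharpA_spec T : in_BA ip A T ->
  bounded_op ip (sharpA ip A T) /\
  (forall x y, ipA ip A (T x) y = ipA ip A x (sharpA ip A T y)).
Proof.
move=> [hT [S [hS TS]]].
have [P [hP PM AP]] := closure_range_projection.
have /(epsilon_spec (inhabits (fun x : H => x))) [h1 [h2 _]] :
  exists X : H -> H, bounded_op ip X /\
       (forall x, A (X x) = adjoint ip T (A x)) /\
       (forall x, in_closure_range ip A (X x)).
  exists (P \o S); split; last split=> x /=; rewrite ?AP//.
    split=> [a x y|]; first by rewrite /= hS.1 hP.1.
    have [K [K0 hK]] := bounded_op_bound hP.
    have [L [L0 hL]] := bounded_op_bound hS.
    exists (K * L) => x /=; apply: le_trans (hK _) _.
    by rewrite -mulrA ler_wpM2l.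
  apply: (Re_ip_inj hH) => z.
  rewrite (Re_ipC hH) -positive_op_selfadjoint (Re_ipC hH (adjoint _ _ _)).
  by rewrite -(adjointP hH hT) -positive_op_selfadjoint -[ip _ _]TS.
split=> // x y.
by rewrite /ipA !positive_op_selfadjoint [A (_ y)]h2 -(adjointP hH hT).
Qed.

Lemma bounded_op_scale a T : bounded_op ip T -> bounded_op ip (fun x => a *: T x).
Proof.
move=> hT; split=> [c x y|].
  by rewrite hT.1 scalerDr !scalerA mulrC.
have [M [M0 hM]] := bounded_op_bound hT.
exists (normc a * M) => x; rewrite (hnormZ hH) -mulrA ler_wpM2l ?normc_nneg//.
Qed.

Lemma bounded_op_add T S : bounded_op ip T -> bounded_op ip S ->
  bounded_op ip (fun x => T x + S x).
Proof.
move=> hT hS; split=> [c x y|].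
  by rewrite hT.1 hS.1 scalerDr addrACA.
have [[M hM] [N hN]] := (hT.2, hS.2); exists (M + N) => x.
apply: le_trans (seminormD hbip _ _) _.
by rewrite mulrDl; apply: lerD; [exact: hM|exact: hN].
Qed.

Lemma in_BA_scale a T : in_BA ip A T -> in_BA ip A (fun x => a *: T x).
Proof.
move=> [hT [S [hS TS]]]; split; first exact: bounded_op_scale.
exists (fun x => conjc a *: S x); split; first exact: bounded_op_scale.
by move=> x y; rewrite ipAZl TS /ipA (ipZr hH) conjcK.
Qed.

Lemma in_BA_add T S : in_BA ip A T -> in_BA ip A S -> in_BA ip A (fun x => T x + S x).
Proof.
move=> [hT [T' [hT' TT']]] [hS [S' [hS' SS']]]; split; first exact: bounded_op_add.
exists (fun x => T' x + S' x); split; first exact: bounded_op_add.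
move=> x y; have [hb _] := hA.
have AD := rlinearD (bounded_op_rlinear hb).
rewrite /ipA AD (ipDl hH) -![ip (A _) y]/(ipA ip A _ y) TT' SS' /ipA.
by rewrite (ipDr hH).
Qed.

(** [S T] is A-symmetric and [|T x|_A^2 = Re <x, S T x>_A], so it suffices to bound [S T] in the
    A-seminorm. Its iterates grow at most like [(L K)^n] in the Hilbert norm, hence in the
    A-seminorm, and [seminorm_le_growth] concludes. *)
Lemma in_BA_bound T : in_BA ip A T ->
  exists k, 0 <= k /\ forall x, normA ip A (T x) <= k * normA ip A x.
Proof.
move=> [hT [S [hS TS]]].
have [K [K0 hK]] := bounded_op_bound hT.
have [L [L0 hL]] := bounded_op_bound hS.
have [M [M0 hM]] := bounded_op_bound hA.1.
have hB x : hnorm ip (S (T x)) <= L * K * hnorm ip x.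
  by apply: le_trans (hL _) _; rewrite -mulrA ler_wpM2l.
have LK0 : 0 <= L * K by rewrite mulr_ge0.
have normA_le x : normA ip A x <= Num.sqrt M * hnorm ip x.
  rewrite (seminorm_le_sqr ipA_semi_ip) ?mulr_ge0 ?sqrtr_ge0//.
  rewrite exprMn sqr_sqrtr// expr2 mulrA.
  apply: le_trans (sip_le_seminorm hbip _ _) _.
  by rewrite ler_wpM2r ?sqrtr_ge0 ?hM.
have TS' x y : re (ipA ip A (S (T x)) y) = re (ipA ip A x (S (T y))).
  by rewrite -TS (sip_sym ipA_semi_ip) -TS (sip_sym ipA_semi_ip).
(* The constant may depend on [x], which is why the Hilbert norm of [x] is allowed here. *)
have grow x : exists C, forall n, normA ip A (iter n (S \o T) x) <= C * (L * K) ^+ n.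
  exists (Num.sqrt M * hnorm ip x) => n; apply: le_trans (normA_le _) _.
  rewrite -mulrA ler_wpM2l ?sqrtr_ge0//.
  elim: n => [|n IH] /=; first by rewrite mulr1.
  by apply: le_trans (hB _) _; rewrite exprS mulrCA ler_wpM2l.
have bd := seminorm_le_growth ipA_semi_ip LK0 TS' grow.
exists (Num.sqrt (L * K)); split=> [|x]; first exact: sqrtr_ge0.
rewrite (seminorm_le_sqr ipA_semi_ip) ?mulr_ge0 ?sqrtr_ge0//.
rewrite exprMn sqr_sqrtr// TS; apply: le_trans (sip_le_seminorm ipA_semi_ip _ _) _.
by rewrite mulrC expr2 mulrA ler_wpM2r ?sqrtr_ge0//; exact: bd.
Qed.
End SemiHilbert.

(** [sup] defaults to 0 on sets that are empty or unbounded above. *)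
Lemma sup_nneg {R : realType} (E : set R) : (forall r, E r -> 0 <= r) -> 0 <= sup E.
Proof.
move=> h; have [hE|/sup_out->//] := pselect (has_sup E).
have [r Er] := hE.1; exact: le_trans (h _ Er) (sup_upper_bound hE Er).
Qed.

(** * A-numerical radius and rotated real parts *)

Section NumericalRadius.
Variables (R : realType) (H : lmodType R[i]) (ip : H -> H -> R[i]).
Hypothesis hH : is_hilbert ip.
Variables (A : H -> H) (hA : positive_op ip A).
Local Notation re := (@complex.Re R).
Local Notation normc := ComplexField.Normc.normc.
Local Notation bA x y := (re (ipA ip A x y)).
Local Notation hbA := (ipA_semi_ip hH hA).

Lemma normA_ge0 x : 0 <= normA ip A x. Proof. exact: sqrtr_ge0. Qed.

Lemma sqr_normA x : normA ip A x ^+ 2 = bA x x.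
Proof. exact: sqr_seminorm hbA x. Qed.

Lemma omegaA_ge0 T : 0 <= omegaA ip A T.
Proof. by apply: sup_nneg => _ [x [_ ->]]; exact: normc_nneg. Qed.

Lemma opnormA_ge0 T : 0 <= opnormA ip A T.
Proof. by apply: sup_nneg => _ [x [_ ->]]; exact: normA_ge0. Qed.

Lemma normA_normalize x : normA ip A x != 0 ->
  normA ip A ((normA ip A x)^-1 *r x) = 1.
Proof.
move=> x0; rewrite [LHS](seminormZ hbA) ger0_norm ?invr_ge0 ?normA_ge0//.
exact: mulVf.
Qed.

(** [in_BA_bound] makes the supremum finite, and normalizing gives the bound; vectors of A-seminorm
    0 cannot be normalized and are handled by Cauchy-Schwarz. *)
Lemma le_omegaA T (hT : in_BA ip A T) x :
  normc (ipA ip A (T x) x) <= omegaA ip A T * bA x x.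
Proof.
have [k [k0 hk]] := in_BA_bound hH hA hT.
have ub : has_ubound [set r : R | exists x : H, normA ip A x = 1 /\ r = normc (ipA ip A (T x) x)].
  exists k => _ [y [y1 ->]]; apply: le_trans (ipA_cauchy_schwarz hH hA _ _) _.
  by have := hk y; rewrite y1 !mulr1.
rewrite -sqr_normA; have [x0|x0] := eqVneq (normA ip A x) 0.
  apply: le_trans (ipA_cauchy_schwarz hH hA _ _) _.
  by rewrite x0 expr2 !mulr0.
have n0 : 0 < normA ip A x by rewrite lt0r x0 normA_ge0.
rewrite -ler_pdivrMr ?exprn_gt0//; apply: (ub_le_sup ub).
set y := (normA ip A x)^-1 *r x.
exists y; split; first exact: normA_normalize.
rewrite /y (bounded_opZ hT.1) (ipAZl hH hA) /ipA (ipZr hH).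
have cr r : normc (real_complex R r) = `|r|.
  by rewrite /= expr0n /= addr0 sqrtr_sqr.
rewrite conjc_real !ComplexField.Normc.normcM cr ger0_norm ?invr_ge0 ?normA_ge0//.
by field.
Qed.

Lemma Re_expi_le_omegaA T (hT : in_BA ip A T) t x :
  `|re (expi t * ipA ip A (T x) x)| <= omegaA ip A T * bA x x.
Proof. exact: le_trans (Re_expi_le _ _) (le_omegaA hT _). Qed.

Section ReA.
Variables (T : H -> H) (hT : in_BA ip A T) (t : R).
Local Notation P := (ReA ip A (fun y => expi t *: T y)).

Let hTt : in_BA ip A (fun y => expi t *: T y) := in_BA_scale hH hA (expi t) hT.

Lemma half_real : (2 : R[i])^-1 = real_complex R 2^-1.
Proof. by rewrite fmorphV rmorphMn /= rmorph1. Qed.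

(** Eliminates [sharpA] in favour of [T]; symmetry and the diagonal values of the real part are read
    off this formula. *)
Lemma Re_ipA_ReA x y : bA (P x) y =
  2^-1 * (bA (expi t *: T x) y + bA x (expi t *: T y)).
Proof.
have [_ hs] := sharpA_spec hH hA hTt.
rewrite /ReA half_real (sipZl hbA) (sipDl hbA).
congr (_ * (_ + _)).
by rewrite (sip_sym hbA) -hs (sip_sym hbA).
Qed.

Lemma ReA_sym x y : bA (P x) y = bA x (P y).
Proof.
rewrite (sip_sym hbA x) !Re_ipA_ReA.
rewrite (sip_sym hbA y) (sip_sym hbA (expi t *: T y)).
by rewrite [in RHS]addrC.
Qed.

Lemma ReA_diag x : bA (P x) x = re (expi t * ipA ip A (T x) x).
Proof.
rewrite Re_ipA_ReA (sip_sym hbA x) (ipAZl hH hA); lra.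
Qed.

Lemma ReA_rlinear : rlinear P.
Proof.
have [hs _] := sharpA_spec hH hA hTt.
move=> r x y; have eT : expi t *: T (r *r x + y) = r *r (expi t *: T x) + expi t *: T y.
  exact: hTt.1.1.
by rewrite /ReA eT hs.1 addrACA scalerDr -(scalerDr (real_complex R r)) scalerA mulrC -scalerA.
Qed.

Lemma normA_ReA_le x : normA ip A (P x) <= omegaA ip A T * normA ip A x.
Proof.
apply: (seminorm_le_numerical_radius hbA).
- exact: omegaA_ge0.
- exact: ReA_rlinear.
- exact: ReA_sym.
- by move=> z; rewrite ReA_diag; exact: Re_expi_le_omegaA.
Qed.
End ReA.

(** * The A-numerical radius of a sum *)

Section Sum.
Variables (T S : H -> H) (hT : in_BA ip A T) (hS : in_BA ip A S).
Local Notation P t := (ReA ip A (fun y => expi t *: T y)).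
Local Notation Q t := (ReA ip A (fun y => expi t *: S y)).
Local Notation wT := (omegaA ip A T).
Local Notation wS := (omegaA ip A S).
Local Notation m := (sup [set r : R | exists t : R,
      r = opnormA ip A (fun x => P t (Q t x))]).

Lemma normA_ReA_prod_le t x : normA ip A (P t (Q t x)) <= wT * wS * normA ip A x.
Proof.
apply: le_trans (normA_ReA_le hT _ _) _.
by rewrite -mulrA ler_wpM2l ?omegaA_ge0// normA_ReA_le.
Qed.

Lemma opnormA_ReA_prod_ub t : ubound [set r : R | exists x : H,
  normA ip A x = 1 /\ r = normA ip A (P t (Q t x))] (wT * wS).
Proof.
by move=> _ [x [x1 ->]]; have := normA_ReA_prod_le t x; rewrite x1 mulr1.
Qed.

Lemma opnormA_ReA_prod_le t : opnormA ip A (fun x => P t (Q t x)) <= wT * wS.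
Proof.
rewrite /opnormA; set E := (X in sup X).
have [/ge_sup h|/set0P/negP/negPn/eqP ->] := pselect (E !=set0).
  by apply: h; exact: opnormA_ReA_prod_ub.
by rewrite sup0 mulr_ge0 ?omegaA_ge0.
Qed.

Lemma sup_opnormA_le : m <= wT * wS.
Proof.
apply: ge_sup => [|_ [t ->]]; last exact: opnormA_ReA_prod_le.
by exists (opnormA ip A (fun x => P 0 (Q 0 x))); exists 0.
Qed.

Lemma le_sup_opnormA t : opnormA ip A (fun x => P t (Q t x)) <= m.
Proof.
apply: ub_le_sup; last by exists t.
by exists (wT * wS) => _ [s ->]; exact: opnormA_ReA_prod_le.
Qed.

Lemma sup_opnormA_ge0 : 0 <= m.
Proof. exact: le_trans (opnormA_ge0 _) (le_sup_opnormA 0). Qed.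

(* Near-extremal vectors for [omegaA (T + S)] are approximate eigenvectors of
   a rotated real part [P t + Q t], for the eigenvalue [omegaA (T + S)]. *)
Lemma omegaA_add_char (M := omegaA ip A (fun x => T x + S x)) :
  (exists x, A x <> 0) -> wT <= M -> wS <= M -> (M - wT) * (M - wS) <= m.
Proof.
move=> hA0 wTM wSM; have hTS := in_BA_add hH hA hT hS.
have M0 : 0 <= M := omegaA_ge0 _.
pose E := [set r : R | exists x : H, normA ip A x = 1 /\
  r = normc (ipA ip A (T x + S x) x)].
(* A vector with [A z <> 0] has nonzero A-seminorm by Cauchy-Schwarz, so A-unit vectors exist. *)
have E0 : E !=set0.
  have [z Az] := hA0; have z0 : normA ip A z != 0.
    apply/eqP => z0; apply: Az; apply: (Re_ip_inj hH) => w.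
    rewrite (ip0l hH); apply/eqP; rewrite -normr_le0.
    by have := sip_cauchy_schwarz hbA z w; rewrite -[seminorm _ z]/(normA ip A z) z0 mul0r.
  pose y := (normA ip A z)^-1 *r z.
  by exists (normc (ipA ip A (T y + S y) y)), y; split=> //; exact: normA_normalize.
apply: (@ler_addgt0 _ _ _ (M * Num.sqrt (2 * M))) => e e0.
(* The slack is [e^2] because the residual [M x - N x] is controlled through its square. *)
have [|_ [x [x1 ->]] hx] := @sup_gt _ E (M - e ^+ 2) E0.
  by rewrite ltrBlDr ltrDl exprn_gt0.
have [t ht] := normc_phase (ipA ip A (T x + S x) x).
pose N y := P t y + Q t y.
have Ndiag y : bA (N y) y = re (expi t * ipA ip A (T y + S y) y).
  rewrite /N (sipDl hbA) !ReA_diag// -Re_add -mulrDr; congr (re (_ * _)).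
  by rewrite /ipA (rlinearD (bounded_op_rlinear hA.1)) (ipDl hH).
have NM : normA ip A (N x) <= M.
  rewrite -[leRHS]mulr1 -x1; apply: (seminorm_le_numerical_radius hbA) => //.
  - by move=> r y z; rewrite /N !ReA_rlinear// scalerDr addrACA.
  - move=> y z; rewrite /N (sipDl hbA) (sipDr hbA).
    by congr (_ + _); exact: ReA_sym.
  - by move=> y; rewrite Ndiag; exact: (Re_expi_le_omegaA hTS).
(* The square is [M^2 - 2 M <N x, x>_A + |N x|_A^2], at most [2 M^2 - 2 M (M - e^2) = 2 M e^2]. *)
have D : normA ip A (M *r x - N x) <= Num.sqrt (2 * M) * e.
  rewrite (seminorm_le_sqr hbA) ?mulr_ge0 ?sqrtr_ge0 ?(ltW e0)//.
  rewrite exprMn sqr_sqrtr ?mulr_ge0//.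
  have N2 : bA (N x) (N x) <= M ^+ 2.
    by rewrite -sqr_normA ler_pXn2r ?nnegrE ?normA_ge0.
  have x2 : bA x x = 1 by rewrite -sqr_normA x1 expr1n.
  have : M * (M - e ^+ 2) <= M * bA (N x) x.
    by rewrite ler_wpM2l// Ndiag ht ltW.
  have E2 y z : bA (M *r y - z) (M *r y - z) =
      M ^+ 2 * bA y y - 2 * (M * bA z y) + bA z z.
    rewrite !(sipE hbA).
    have -> : bA y z = bA z y := sip_sym hbA y z.
    by ring.
  by rewrite E2 x2; lra.
have := seminorm_resolvent_prod hbA (ReA_rlinear hT t)
  (normA_ReA_le hT t) (normA_ReA_le hS t) x wTM wSM.
rewrite -![seminorm _ _]/(normA ip A _) x1 mulr1 ger0_norm// => h.
have PQ : normA ip A (P t (Q t x)) <= m.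
  apply: le_trans (le_sup_opnormA t); apply: ub_le_sup; last by exists x.
  by exists (wT * wS); exact: opnormA_ReA_prod_ub.
have : M * normA ip A (M *r x - N x) <= M * (Num.sqrt (2 * M) * e) by rewrite ler_wpM2l.
rewrite /N in h *; lra.
Qed.
End Sum.
End NumericalRadius.

(** [(2 M - a - c)^2 = (a - c)^2 + 4 (M - a) (M - c)]. If [M] lies below [a] or [c], then
    [2 M - a - c <= |a - c|] settles the claim, so the product bound is only asked for in the other
    case. *)
Lemma quadratic_root_bound {R : rcfType} (M a c m : R) :
  0 <= m -> (a <= M -> c <= M -> (M - a) * (M - c) <= m) ->
  M <= 2^-1 * (a + c + Num.sqrt ((a - c) ^+ 2 + 4 * m)).
Proof.
move=> m0 h.
have d0 : 0 <= (a - c) ^+ 2 + 4 * m by rewrite addr_ge0 ?sqr_ge0// mulr_ge0.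
suff : 2 * M - a - c <= Num.sqrt ((a - c) ^+ 2 + 4 * m) by lra.
have [|aM] := leP a M; last first.
  apply: (@le_trans _ _ `|a - c|); first by have := ler_norm (a - c); lra.
  by rewrite -sqrtr_sqr ler_sqrt// lerDl mulr_ge0.
have [|cM] := leP c M; last first.
  move=> _; apply: (@le_trans _ _ `|a - c|); first by have := ler_norm (c - a); rewrite distrC; lra.
  by rewrite -sqrtr_sqr ler_sqrt// lerDl mulr_ge0.
move=> cM aM; apply: le_trans (ler_norm _) _.
rewrite -sqrtr_sqr ler_sqrt//; have := h aM cM; nra.
Qed.

Unset Implicit Arguments.

Theorem theorem3p4 (R : realType) (H : lmodType R[i]) (ip : H -> H -> R[i])
  (hH : is_hilbert ip) (A : H -> H) (hA : positive_op ip A)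
  (hA0 : exists x : H, A x <> 0) (T S : H -> H)
  (hT : in_BA ip A T) (hS : in_BA ip A S) :
  let wT := omegaA ip A T in
  let wS := omegaA ip A S in
  let m := sup [set r : R | exists t : R,
      r = opnormA ip A (fun x => ReA ip A (fun y => expi t *: T y)
                                   (ReA ip A (fun y => expi t *: S y) x))] in
  omegaA ip A (fun x => T x + S x)
    <= 2^-1 * (wT + wS + Num.sqrt ((wT - wS) ^+ 2 + 4 * m))
  /\ 2^-1 * (wT + wS + Num.sqrt ((wT - wS) ^+ 2 + 4 * m)) <= wT + wS.
Proof.
move=> wT wS m; split.
  apply: quadratic_root_bound; first exact: sup_opnormA_ge0.
  exact: omegaA_add_char.
have w0 : 0 <= wT + wS by rewrite addr_ge0 ?omegaA_ge0.
have : Num.sqrt ((wT - wS) ^+ 2 + 4 * m) <= wT + wS.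
  rewrite -[leRHS]ger0_norm// -sqrtr_sqr ler_sqrt ?sqr_ge0//.
  (* This bounds the radicand by [(wT - wS)^2 + 4 wT wS = (wT + wS)^2]. *)
  have : m <= wT * wS by exact: sup_opnormA_le.
  lra.
lra.
Qed.
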